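(* Let $A, B$ be unital locally matrix algebras over a field $\mathbb{F} = \mathbb{R}$ or $\mathbb{C}$. Let $\varphi \colon A \to B$ be a surjective $\mathbb{F}$-linear mapping that preserves the normalized determinant. Then there exist invertible elements $X, Y \in B$ with $\overline{\det}(XY) = 1$ such that $\varphi$ is of one of the following types: $$\varphi(a) = X\,\varphi_1(a)\,Y, \quad a \in A,$$ where $\varphi_1 \colon A \to B$ is an isomorphism, or $$\varphi(a) = X\,\varphi_2(a)\,Y, \quad a \in A,$$ where $\varphi_2 \colon A \to B$ is an antiisomorphism.
   Context: An associative $\mathbb{F}$-algebra $A$ is a locally matrix algebra if every finite subset of $A$ is contained in a subalgebra isomorphic to a matrix algebra $M_n(\mathbb{F})$ for some $n$; it is unital if it contains an identity element $1_A$. Normalized determinant: let $\mathbb{F}=\mathbb{R}$ or $\mathbb{C}$ and let $A$ be a unital locally matrix algebra over $\mathbb{F}$. For $a \in A$ choose a subalgebra $A' \subset A$ containing $1_A$ and $a$ with $A' \cong M_n(\mathbb{F})$; put $\overline{\det}(a) = |\det(a)|^{1/n}$, where $\det(a)$ is the determinant of $a$ as an $n \times n$ matrix. This does not depend on the choice of $A'$. A linear mapping $\varphi: A \to B$ preserves the normalized determinant if $\overline{\det}(\varphi(a)) = \overline{\det}(a)$ for all $a \in A$. An antihomomorphism $\psi : A \to B$ of associative algebras is a linear mapping with $\psi(a_1 a_2) = \psi(a_2)\psi(a_1)$ for all $a_1, a_2 \in A$; an antiisomorphism is a bijective antihomomorphism. *)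

(* Defs.v *)
From HB Require Import structures.
From mathcomp Require Import all_boot all_order all_algebra.
From mathcomp Require Import all_classical all_reals all_analysis.
From mathcomp Require Import complex.

Set Implicit Arguments.
Unset Strict Implicit.
Unset Printing Implicit Defensive.

Import Order.TTheory GRing.Theory Num.Theory.

Local Open Scope classical_set_scope.
Local Open Scope ring_scope.

(* F is the field of real or of complex numbers, and abs is its absolute
   value.  abs takes its values in R, unlike the norm `|_| of R[i]. *)
Inductive real_or_complex (R : realType) :
    forall F : fieldType, (F -> R) -> Prop :=
| Real_numbers : @real_or_complex R R (fun x : R => `|x|)
| Complex_numbers : @real_or_complex R R[i] (@ComplexField.Normc.normc R).

Definition is_subalgebra (F : fieldType) (A : algType F) (S : set A) : Prop :=
  [/\ S 0,
      forall a b, S a -> S b -> S (a + b),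
      forall (c : F) a, S a -> S (c *: a) &
      forall a b, S a -> S b -> S (a * b)].

(* S need not contain the identity of A, so f need not send 1%:M to 1. *)
Definition matrix_iso (F : fieldType) (A : algType F) (n : nat)
    (f : {linear 'M[F]_n -> A}) (S : set A) : Prop :=
  (forall M N : 'M[F]_n, f (M *m N) = f M * f N) /\
  set_bij [set: 'M[F]_n] S f.

(* The objects of algType F are unital, with 1 != 0. *)
Definition locally_matrix (F : fieldType) (A : algType F) : Prop :=
  forall s : set A, finite_set s ->
    exists2 S : set A, is_subalgebra S /\ s `<=` S &
    exists n : nat, (0 < n)%N /\
    exists f : {linear 'M[F]_n -> A}, matrix_iso f S.

(* The value does not depend on the choice of S, n and f when A is locally
   matrix; xget selects one, and the default 0 is then never used. *)
Definition norm_det (R : realType) (F : fieldType) (abs : F -> R)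
    (A : algType F) (a : A) : R :=
  xget 0 [set d : R |
    exists2 S : set A, [/\ is_subalgebra S, S 1 & S a] &
    exists n : nat, (0 < n)%N /\
    exists f : {linear 'M[F]_n -> A}, matrix_iso f S /\
    exists2 M : 'M[F]_n, f M = a & d = abs (\det M) `^ n%:R^-1].

Definition preserves_norm_det (R : realType) (F : fieldType) (abs : F -> R)
    (A B : algType F) (phi : A -> B) : Prop :=
  forall a : A, norm_det abs (phi a) = norm_det abs a.

Definition invertible (F : fieldType) (A : algType F) (x : A) : Prop :=
  exists y : A, y * x = 1 /\ x * y = 1.

Definition antihomomorphism (F : fieldType) (A B : algType F)
    (psi : {linear A -> B}) : Prop :=
  forall a1 a2 : A, psi (a1 * a2) = psi a2 * psi a1.

(* Main.v *)
From HB Require Import structures.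
Require Import Defs.
From mathcomp Require Import all_boot all_order all_algebra.
From mathcomp Require Import all_fingroup.
From mathcomp Require Import all_classical all_reals all_analysis.
From mathcomp Require Import complex.

Set Implicit Arguments.
Unset Strict Implicit.
Unset Printing Implicit Defensive.

Import Order.TTheory GRing.Theory Num.Theory.

Local Open Scope classical_set_scope.
Local Open Scope ring_scope.

(* The element [X := phi 1] has normalized determinant 1, so it is invertible
   and [psi := X^-1 * phi] is a unital map preserving normalized determinants.
   Let [psi] send matrices [M, L] of size [n] to matrices [N, K] of size [m].
   Then [|det(1 + sM + tL)|^m = |det(1 + sN + tK)|^n] for all scalars [s, t].
   A polynomial with constant term 1 is determined by its absolute value, so
   comparing the coefficients of [t], and then those of [1], [s], [s^2], gives
   [tr(M^k L)/n = tr(N^k K)/m] for [k < 3]. Both [psi(c)^2] and [psi(c^2)] thus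
   have the same normalized trace pairing with every [psi(b)], and the trace
   form is nondegenerate: [psi] is a Jordan isomorphism. As a locally matrix
   algebra is prime, it is multiplicative or antimultiplicative (Herstein,
   Smiley). *)

(** * Jordan homomorphisms onto prime rings *)

(** Writes [2aba] in terms of squares and anticommutators, which a Jordan map respects. *)
Lemma anticomm_anticomm (R : pzRingType) (a b : R) :
  a * (a * b + b * a) + (a * b + b * a) * a
  = a * a * b + b * (a * a) + (a * b * a + a * b * a).
Proof.
by rewrite mulrDr mulrDl !mulrA [a * b * a + b * a * a]addrC addrACA.
Qed.

(** To be read with [p = psi (a * b)], [s = psi a * psi b] and [t = psi b * psi a]; then [s + t - p]
    is [psi (b * a)]. *)
Lemma product_conjugate_zero (R : pzRingType) (p s t y : R) :
  s * y * t + t * y * s = p * y * (s + t - p) + (s + t - p) * y * p ->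
  (p - s) * y * (p - t) + (p - t) * y * (p - s) = 0.
Proof.
(* The differences [u = p - s] and, below, [w = t - u] become the variables, so that few signs
   survive the expansion. *)
have [u ->] : exists u, p = u + s by exists (p - s); rewrite subrK.
rewrite addrK => e.
have {e} : s * y * t + t * y * s
  = (u + s) * y * (t - u) + (t - u) * y * (u + s).
  by rewrite e [u + s]addrC opprD addrACA subrr add0r.
have -> : u + s - t = s - (t - u) by rewrite opprB addrCA addrA.
have [w ->] : exists w, t = w + u by exists (t - u); rewrite subrK.
rewrite addrK !(mulrBr, mulrDr, mulrBl, mulrDl) => e.
rewrite addrACA -opprD; apply/eqP; rewrite subr_eq0; apply/eqP.
apply: (addrI (s * y * w + w * y * s)).
rewrite [RHS]addrC [RHS]addrACA -e.
by rewrite [u * y * s + _]addrC addrACA.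
Qed.

Section JordanMaps.
Variables (R S : nzRingType) (psi : {additive R -> S}).
Hypothesis two_reg : forall x : S, x + x = 0 -> x = 0.
Hypothesis S_prime :
  forall x y : S, (forall z, x * z * y = 0) -> x = 0 \/ y = 0.
Hypothesis psi_sqr : forall a, psi (a * a) = psi a * psi a.

Lemma jordan_anticomm a b :
  psi (a * b + b * a) = psi a * psi b + psi b * psi a.
Proof.
have := psi_sqr (a + b); rewrite !(mulrDl, mulrDr) !raddfD !psi_sqr /=.
by rewrite mulrDl !mulrDr -!addrA => /addrI; rewrite !addrA => /addIr.
Qed.

(** Apply [psi] to [anticomm_anticomm]: everything except [2aba] is already known, and the factor 2
    cancels by [two_reg]. *)
Lemma jordan_triple a b : psi (a * b * a) = psi a * psi b * psi a.
Proof.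
suff e2 : psi (a * b * a) + psi (a * b * a)
        = psi a * psi b * psi a + psi a * psi b * psi a.
  apply/eqP; rewrite -subr_eq0; apply/eqP/two_reg.
  by rewrite addrACA e2 -opprD subrr.
have : psi (a * (a * b + b * a) + (a * b + b * a) * a)
     = psi (a * a * b + b * (a * a) + (a * b * a + a * b * a)).
  by rewrite anticomm_anticomm.
rewrite !jordan_anticomm anticomm_anticomm.
by rewrite raddfD jordan_anticomm raddfD psi_sqr => /addrI /esym.
Qed.

Lemma jordan_triple_sym a b c : psi (a * b * c + c * b * a)
  = psi a * psi b * psi c + psi c * psi b * psi a.
Proof.
have := jordan_triple (a + c) b.
rewrite raddfD !(mulrDl, mulrDr) !raddfD /= !jordan_triple.
rewrite -!addrA => /addrI; rewrite !addrA => /addIr.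
by rewrite addrC => ->; rewrite addrC.
Qed.

(** The hypothesis exchanges [u] and [v] at the cost of a sign. Exchanging the outer pair of
    [uzvwuzv] once, or two inner pairs in turn, gives [vzvwuzu] with opposite signs, so
    [uzvwuzv = 0]; primeness is then used twice. *)
Lemma prime_symmetric_product (u v : S) :
  (forall z, u * z * v + v * z * u = 0) -> u = 0 \/ v = 0.
Proof.
move=> uv; have swap z : u * z * v = - (v * z * u).
  by apply/eqP; rewrite -addr_eq0 uv.
apply: S_prime => z.
suff uzv w : u * z * v * w * (u * z * v) = 0 by have [] := S_prime uzv.
have e1 : u * z * v * w * (u * z * v) = - (v * z * v * w * (u * z * u)).
  by have := swap (z * v * w * u * z); rewrite !mulrA.
have e2 : u * z * v * w * (u * z * v) = v * z * v * w * (u * z * u).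
  have -> : u * z * v * w * (u * z * v) = - (v * z * (u * (w * u * z) * v)).
    by rewrite {1}swap !mulNr !mulrA.
  by rewrite swap mulrN opprK !mulrA.
by apply: two_reg; rewrite {1}e1 e2 addNr.
Qed.

Hypothesis psi_surj : forall y, exists x, psi x = y.

(* Expand [psi] of [abzba + bazab] once as two nested triple products and once
   as the symmetric triple product of [ab], [z], [ba]. *)
Lemma jordan_mul_or_antimul a b :
  psi (a * b) = psi a * psi b \/ psi (a * b) = psi b * psi a.
Proof.
suff: psi (a * b) - psi a * psi b = 0 \/ psi (a * b) - psi b * psi a = 0.
  by case=> /subr0_eq; [left | right].
apply: prime_symmetric_product => y; have [z <-] := psi_surj y.
have e1 := jordan_triple_sym (a * b) z (b * a).
have e2 : psi (a * b * z * (b * a) + b * a * z * (a * b)) =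
  psi a * psi b * psi z * (psi b * psi a)
  + psi b * psi a * psi z * (psi a * psi b).
  rewrite raddfD; congr (_ + _).
    have -> : a * b * z * (b * a) = a * (b * z * b) * a by rewrite !mulrA.
    by rewrite !jordan_triple !mulrA.
  have -> : b * a * z * (a * b) = b * (a * z * a) * b by rewrite !mulrA.
  by rewrite !jordan_triple !mulrA.
have e3 : psi (b * a) = psi a * psi b + psi b * psi a - psi (a * b).
  by rewrite -jordan_anticomm raddfD addrAC subrr add0r.
move: e1; rewrite {}e2 {}e3.
by move=> e; apply: product_conjugate_zero; rewrite -e.
Qed.


(** A group is not the union of two proper subgroups. This is used for the [b] satisfying [H a b] or
    [K a b] with [a] fixed, then for the [a] whose whole row satisfies [H] or [K]. *)
Lemma jordan_hom_or_antihom :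
  (forall a b, psi (a * b) = psi a * psi b) \/
  (forall a b, psi (a * b) = psi b * psi a).
Proof.
pose H a b := psi (a * b) = psi a * psi b.
pose K a b := psi (a * b) = psi b * psi a.
have HK a b : H a b \/ K a b by exact: jordan_mul_or_antimul.
have row a : (forall b, H a b) \/ (forall b, K a b).
  have [|] := EM (forall b, H a b); first by left.
  move=> /existsNP[b nHb]; right=> c.
  have [//|Kc] := EM (K a c).
  have Kb : K a b by case: (HK a b).
  have Hc : H a c by case: (HK a c).
  have [Hbc|Kbc] := HK a (b + c).
    by case: nHb; move: Hbc; rewrite /H mulrDr !raddfD mulrDr Hc => /addIr.
  by move: Kbc; rewrite /K mulrDr !raddfD mulrDl Kb => /addrI.
have [|] := EM (forall a b, H a b); first by left.
move=> /existsNP[a nHa]; right=> c.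
have Ka : forall b, K a b by case: (row a).
have [|/existsNP[d nKd]] := EM (forall b, K c b); first by [].
have Hc : forall b, H c b by case: (row c) => // Kc; case: nKd.
have [Hac|Kac] := row (a + c).
  case: nHa => b; have := Hac b.
  by rewrite /H mulrDl !raddfD mulrDl Hc => /addIr.
case: nKd; have := Kac d.
by rewrite /K mulrDl !raddfD mulrDr Ka => /addrI.
Qed.
End JordanMaps.

(** * Absolute values determining polynomials *)

(** Common interface to the real and complex absolute values; the proofs of [absval_poly] for the
    two fields differ in substance. *)
Record absval (F : fieldType) (R : realDomainType) (abs : F -> R) : Prop :=
  AbsVal {
    absval_char0 : forall k : nat, k.+1%:R != 0 :> F;
    absvalM : {morph abs : x y / x * y};
    absval_ge0 : forall x, 0 <= abs x;
    absval1 : abs 1 = 1;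
    absval_eq0 : forall x, (abs x == 0) = (x == 0);
    absval_poly : forall p q : {poly F}, p.[0] = 1 -> q.[0] = 1 ->
      (forall x, abs p.[x] = abs q.[x]) -> p = q }.

Lemma absvalX (F : fieldType) (R : realDomainType) (abs : F -> R) x k :
  absval abs -> abs (x ^+ k) = abs x ^+ k.
Proof.
move=> absP; elim: k => [|k IH]; first by rewrite !expr0 absval1.
by rewrite !exprS (absvalM absP) IH.
Qed.

Section CharZero.
Variable F : fieldType.
Hypothesis char0 : forall k : nat, k.+1%:R != 0 :> F.

Lemma mulrSn_inj k : injective (fun x : F => x *+ k.+1).
Proof.
move=> x y; rewrite -[x *+ _]mulr_natr -[y *+ _]mulr_natr.
exact: mulIf (char0 k) _ _.
Qed.

Lemma natr_inj k l : k%:R = l%:R :> F -> k = l.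
Proof.
wlog kl : k l / (k <= l)%N => [H e|].
  by case: (leqP k l) => [|/ltnW] kl; [|apply/esym]; apply: H.
move/eqP; rewrite eq_sym -subr_eq0 -natrB // => /eqP.
case E: (l - k)%N => [|d] e; last by case/eqP: (char0 d).
by apply/eqP; rewrite eqn_leq kl -subn_eq0 E.
Qed.

(** Sampling starts at 1, so that identities proved by dividing by the sample point qualify. *)
Lemma poly_eq0_natr (p : {poly F}) :
  (forall k : nat, p.[k.+1%:R] = 0) -> p = 0.
Proof.
move=> p0; apply/eqP/negPn/negP => /max_poly_roots.
move=> /(_ [seq k.+1%:R | k <- iota 0 (size p)]); rewrite size_map size_iota.
rewrite ltnn => H; suff : false by [].
apply: H; first by apply/allP => _ /mapP[k _ ->]; rewrite /root p0.
by rewrite map_inj_uniq ?iota_uniq // => k l /natr_inj [].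
Qed.

Lemma poly_eq_natr (p q : {poly F}) :
  (forall k : nat, p.[k.+1%:R] = q.[k.+1%:R]) -> p = q.
Proof.
move=> pq; apply/eqP; rewrite -subr_eq0; apply/eqP/poly_eq0_natr => k.
by rewrite hornerD hornerN pq subrr.
Qed.

End CharZero.

(** The squares agree, so [p] is [q] or [- q], and the constant term decides the sign. *)
Lemma real_poly_eq (R : realFieldType) (p q : {poly R}) :
  p.[0] = 1 -> q.[0] = 1 -> (forall x, `|p.[x]| = `|q.[x]|) -> p = q.
Proof.
move=> p0 q0 pq.
have c0 k : k.+1%:R != 0 :> R by rewrite pnatr_eq0.
have : p ^+ 2 = q ^+ 2.
  apply: (poly_eq_natr c0) => k; rewrite !horner_exp.
  by rewrite -[LHS]real_normK ?num_real // pq real_normK ?num_real.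
move/eqP; rewrite eqf_sqr => /orP[/eqP //|/eqP pNq].
move: p0; rewrite pNq hornerN q0 => /eqP; rewrite eq_sym -subr_eq0 opprK.
by rewrite -[1 + 1]/(2%:R) pnatr_eq0.
Qed.

Section Complex.
Variable R : rcfType.
Notation C := R[i].
Local Notation conjp p := (map_poly (@conjc R) p).

Lemma complex_char0 k : k.+1%:R != 0 :> C.
Proof. by rewrite pnatr_eq0. Qed.

(* Polarization: the hypothesis is an identity between polynomials in
   [Re z] and [Im z], so [z] and its conjugate may be treated as independent
   variables. *)
Lemma complex_poly_polarize (p q : {poly C}) :
  (forall z, p.[z] * (p.[z])^*%C = q.[z] * (q.[z])^*%C) ->
  forall z w, p.[z] * (conjp p).[w] = q.[z] * (conjp q).[w].
Proof.
move=> pq.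
have conjE (r : {poly C}) z : (r.[z])^*%C = (conjp r).[z^*%C].
  by rewrite horner_map.
pose G (r : {poly C}) (x y : C) := r.[x + 'i%C * y] * (conjp r).[x - 'i%C * y].
have iX : ('i%C : C) * 'i%C = -1 by rewrite -expr2 sqr_i.
have conji : (('i%C : C)^*)%C = - 'i%C.
  by rewrite -[RHS]/((- 0) +i* (- 1))%C oppr0.
have Gnat (j k : nat) : G p j.+1%:R k.+1%:R = G q j.+1%:R k.+1%:R.
  have conjjk : ((j.+1%:R + 'i%C * k.+1%:R : C)^*)%C = j.+1%:R - 'i%C * k.+1%:R.
    rewrite (rmorphD (@conjc R)) (rmorphM (@conjc R)) !(rmorph_nat (@conjc R)).
    by rewrite [X in _ + X * _]conji mulNr.
  by have := pq (j.+1%:R + 'i%C * k.+1%:R); rewrite !conjE conjjk.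
(* [G r] is polynomial in each variable separately, so agreement at pairs of positive integers
   extends first to all [x], then to all [y]. *)
have GX (r : {poly C}) (x y : C) :
  ((r \Po ('X + ('i%C * y)%:P)) * (conjp r \Po ('X - ('i%C * y)%:P))).[x]
  = G r x y.
  by rewrite hornerM !horner_comp !hornerD hornerN !hornerC !hornerX.
have GY (r : {poly C}) (x y : C) :
  ((r \Po (x%:P + 'i%C *: 'X)) * (conjp r \Po (x%:P - 'i%C *: 'X))).[y]
  = G r x y.
  by rewrite hornerM !horner_comp !hornerD hornerN !hornerZ !hornerC !hornerX.
have Gx x (k : nat) : G p x k.+1%:R = G q x k.+1%:R.
  rewrite -!GX; congr (_.[_]); apply: (poly_eq_natr complex_char0) => j.
  by rewrite !GX.
have Gxy x y : G p x y = G q x y.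
  rewrite -!GY; congr (_.[_]); apply: (poly_eq_natr complex_char0) => j.
  by rewrite !GY.
move=> z w; have two0 : (2 : C) != 0 by rewrite pnatr_eq0.
(* The solution of [x + iy = z], [x - iy = w]. *)
pose x := (z + w) / 2; pose y := - ('i%C * ((z - w) / 2)).
have iy : 'i%C * y = (z - w) / 2 by rewrite /y mulrN mulrA iX mulN1r opprK.
have := Gxy x y; rewrite /G iy /x -mulrDl -mulrBl.
have -> : (z + w + (z - w)) / 2 = z.
  by rewrite addrACA subrr addr0 -mulr2n -[z *+ 2]mulr_natr mulfK.
have -> : (z + w - (z - w)) / 2 = w.
  by rewrite opprB addrC subrKA -mulr2n -[w *+ 2]mulr_natr mulfK.
by [].
Qed.

(** Put [w = 0] in the polarized identity: both conjugate factors become 1. *)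
Lemma complex_poly_eq (p q : {poly C}) : p.[0] = 1 -> q.[0] = 1 ->
  (forall z, ComplexField.Normc.normc p.[z] = ComplexField.Normc.normc q.[z]) ->
  p = q.
Proof.
move=> p0 q0 pq; apply: (poly_eq_natr complex_char0) => k.
have conj0 (r : {poly C}) : r.[0] = 1 -> (conjp r).[0] = 1.
  by rewrite !horner_coef0 coef_map /= => ->; rewrite rmorph1.
have sq z : p.[z] * (p.[z])^*%C = q.[z] * (q.[z])^*%C.
  by rewrite -!sqr_normc; congr (_ ^+ 2); rewrite /Num.norm /= pq.
by have := complex_poly_polarize sq k.+1%:R 0; rewrite !conj0 // !mulr1.
Qed.
End Complex.

Lemma real_or_complex_absval (R : realType) (F : fieldType) (abs : F -> R) :
  real_or_complex abs -> absval abs.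
Proof.
case; split => //.
- exact: normrM.
- by rewrite normr1.
- exact: normr_eq0.
- exact: real_poly_eq.
- exact: ComplexField.Normc.normcM.
- by case=> a b /=; rewrite sqrtr_ge0.
- exact: ComplexField.Normc.normc1.
- move=> x; apply/eqP/eqP => [/ComplexField.Normc.eq0_normc //|->].
  exact: ComplexField.Normc.normc0.
- exact: complex_poly_eq.
Qed.

(** * Determinants under morphisms of matrix algebras *)

(** The characteristic polynomial is a power of ['X], so Cayley-Hamilton applies. *)
Lemma strict_trig_nilpotent (F : fieldType) n (N : 'M[F]_n.+1) :
  (forall i j : 'I_n.+1, (i <= j)%N -> N i j = 0) -> N ^+ n.+1 = 0.
Proof.
move=> N0; have := Cayley_Hamilton N; rewrite char_poly_trig; last first.
  by apply/is_trig_mxP => i j /ltnW /N0.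
under eq_bigr do rewrite N0 // subr0.
by rewrite prodr_const card_ord rmorphXn /= horner_mx_X.
Qed.

Lemma trmx_expr (F : fieldType) n (N : 'M[F]_n.+1) k : (N ^+ k)^T = N^T ^+ k.
Proof.
by elim: k => [|k IH]; rewrite ?expr0 ?trmx1 // exprS trmx_mul IH exprSr.
Qed.

Lemma map_polyC_expr (F : fieldType) n (N : 'M[F]_n.+1) k :
  map_mx polyC (N ^+ k) = map_mx polyC N ^+ k.
Proof.
by elim: k => [|k IH]; rewrite ?expr0 ?map_mx1 // !exprS -!mulmxE map_mxM IH.
Qed.

(** A finite geometric series inverts [1 + XN], so its determinant is a unit of [F[X]], hence
    constant; compare its values at 1 and 0. *)
Lemma det_unipotent (F : fieldType) n (N : 'M[F]_n.+1) k :
  N ^+ k = 0 -> \det (1 + N) = 1.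
Proof.
move=> Nk0; pose NX : 'M[{poly F}]_n.+1 := - ('X *: map_mx polyC N).
have NXk : NX ^+ k = 0.
  by rewrite /NX -scaleNr exprZn -map_polyC_expr Nk0 map_mx0 scaler0.
pose p := \det (1 - NX).
have pu : p \is a GRing.unit.
  have /(congr1 (fun M => \det M)) : (1 - NX) * \sum_(i < k) NX ^+ i = 1.
    by rewrite -[LHS]opprK -mulNr opprB -subrX1 NXk sub0r opprK.
  by rewrite -mulmxE det_mulmx det1 => e; apply/unitrPr; eexists; exact: e.
have pc : p = (p`_0)%:P.
  by apply/size1_polyC; move: pu; rewrite poly_unitE => /andP[/eqP ->].
have pE x : p.[x] = \det (1 + x *: N).
  rewrite -[LHS]/(horner_eval x p) /p -det_map_mx; congr (\det _).
  rewrite /NX opprK; apply/matrixP=> i j; rewrite !mxE.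
  by rewrite rmorphD rmorphM rmorph_nat /= /horner_eval hornerX hornerC.
have := pE 1; rewrite scale1r => <-.
by have := pE 0; rewrite scale0r addr0 det1 pc !hornerC.
Qed.

Section DetMorphism.
Variables (F : fieldType) (R : realDomainType) (abs : F -> R).
Hypothesis absP : absval abs.
Let absM := absvalM absP.
Let abs_ge0 := absval_ge0 absP.
Let abs1 := absval1 absP.
Variables (n m : nat) (h : {lrmorphism 'M[F]_n.+1 -> 'M[F]_m.+1}).
Hypothesis h_inj : injective h.

Lemma det_morphM M N : \det (h (M * N)) = \det (h M) * \det (h N).
Proof. by rewrite rmorphM -mulmxE det_mulmx. Qed.

Lemma det_morph_scalar a : \det (h (a%:M)) = a ^+ m.+1.
Proof.
by rewrite -[a%:M]scalemx1 linearZ /= (rmorph1 h) detZ det1 mulr1.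
Qed.

(** A permutation has finite order, and 1 is the only nonnegative root of unity. *)
Lemma abs_det_morph_perm s : abs (\det (h (perm_mx s))) = 1.
Proof.
have sX k : perm_mx s ^+ k = perm_mx (s ^+ k)%g :> 'M[F]_n.+1.
  elim: k => [|k IH]; first by rewrite expg0 perm_mx1.
  by rewrite exprS expgS perm_mxM IH.
have hX k : \det (h (perm_mx s)) ^+ k = \det (h (perm_mx (s ^+ k)%g)).
  elim: k => [|k IH]; first by rewrite -sX !expr0 rmorph1 det1.
  by rewrite exprS IH -det_morphM -!sX -exprS.
have := pexprn_eq1 #[s]%g (abs_ge0 (\det (h (perm_mx s)))).
rewrite -(absvalX _ _ absP) hX expg_order perm_mx1 rmorph1 det1 abs1 eqxx.
by rewrite eqn0Ngt order_gt0 => /esym/eqP.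
Qed.

Lemma det_morph_unipotent N k : N ^+ k = 0 -> \det (h (1 + N)) = 1.
Proof.
move=> Nk; rewrite rmorphD rmorph1; apply: (det_unipotent (k := k)).
by rewrite -rmorphXn Nk rmorph0.
Qed.

(* The cyclic shifts of a diagonal matrix are conjugate to it and multiply up
   to a scalar matrix. *)
Lemma det_morph_diag (d : 'rV[F]_n.+1) :
  \det (h (diag_mx d)) ^+ n.+1 = \det (diag_mx d) ^+ m.+1.
Proof.
(* The sum [i + k] is taken modulo [n.+1]. *)
pose dk k : 'rV[F]_n.+1 := \row_i d 0 (i + k).
have conj k : \det (h (diag_mx (dk k))) = \det (h (diag_mx d)).
  pose s : {perm 'I_n.+1} := perm (@addIr _ k).
  have -> : diag_mx (dk k) = perm_mx s * diag_mx d * perm_mx s^-1.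
    rewrite -!mulmxE -row_permE -col_permE; apply/matrixP=> i j.
    by rewrite !mxE !permE (inj_eq (@addIr _ k)).
  rewrite !det_morphM mulrAC -det_morphM -[_ * perm_mx _]perm_mxM mulgV.
  by rewrite perm_mx1 (rmorph1 h) det1 mul1r.
have prodE (r : seq 'I_n.+1) :
    \prod_(k <- r) diag_mx (dk k) = diag_mx (\row_i \prod_(k <- r) dk k 0 i).
  elim: r => [|k r IH].
    rewrite big_nil -[LHS]/(1%:M) -diag_const_mx; congr diag_mx; apply/rowP=> i.
    by rewrite !mxE big_nil.
  rewrite big_cons IH -mulmxE mulmx_diag; congr diag_mx; apply/rowP=> i.
  by rewrite !mxE big_cons mxE.
have := congr1 (fun M => \det (h M)) (prodE (index_enum _)).
rewrite (big_morph (fun M => \det (h M)) det_morphM (id1 := 1)); last first.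
  by rewrite rmorph1 det1.
under eq_bigr do rewrite conj.
rewrite prodr_const card_ord => ->.
rewrite det_diag -det_morph_scalar -diag_const_mx; congr (\det (h (diag_mx _))).
apply/rowP=> i; rewrite !mxE [RHS](reindex_inj (addrI i)).
by apply: eq_bigr => k _; rewrite mxE.
Qed.

(* In an LUP decomposition the permutation factor has finite order and the
   unipotent factors map to unipotent matrices, so all of them have determinants
   of absolute value 1 and only a diagonal factor remains. *)
Lemma abs_det_morph M :
  abs (\det (h M)) ^+ n.+1 = abs (\det M) ^+ m.+1.
Proof.
have [M0|M0] := eqVneq (\det M) 0.
  have [v v0 vM] := det0P (introT eqP M0).
  have [->|hM0] := eqVneq (\det (h M)) 0.
    have abs0 : abs 0 == 0 by rewrite absval_eq0.
    by rewrite M0 (eqP abs0) !expr0n.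
  (* The square matrix with all rows equal to [v] is one to which [h] applies; if [h M] were
     invertible, [h] would kill it. *)
  suff L0 : const_mx 1 *m v = 0 :> 'M[F]_n.+1.
    case/eqP: v0; apply/rowP=> j.
    have := congr1 (fun A : 'M[F]_n.+1 => A 0 j) L0.
    by rewrite !mxE big_ord1 mxE mul1r.
  apply: h_inj; rewrite rmorph0.
  have hMu : h M \in unitmx by rewrite unitmxE unitfE.
  have h0 : h (const_mx 1 *m v) *m h M = 0.
    by rewrite mulmxE -rmorphM -mulmxE -mulmxA vM mulmx0 rmorph0.
  by rewrite -[LHS](mulmxK hMu) h0 mul0mx.
have := cormen_lup_correct M; have := cormen_lup_perm M.
have := cormen_lup_lower M; have := cormen_lup_upper M.
case: (cormen_lup M) => [[P L] U] /= Uup Llow /is_perm_mxP[s ->] {P} e.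
have L1 : L = 1 + (L - 1) by rewrite addrC subrK.
have nL : (L - 1) ^+ n.+1 = 0.
  by apply: strict_trig_nilpotent => i j ij; rewrite !mxE Llow // subrr.
have := congr1 (fun A => \det A) e.
rewrite -!mulmxE !det_mulmx L1 (det_unipotent nL) mul1r => detU.
have := congr1 (fun A => \det (h A)) e.
rewrite !det_morphM L1 (det_morph_unipotent nL) mul1r => hU.
have -> : abs (\det (h M)) = abs (\det (h U)).
  by rewrite -hU absM abs_det_morph_perm mul1r.
have -> : abs (\det M) = abs (\det U).
  have absN1 : abs (-1) = 1.
    have := pexprn_eq1 2 (abs_ge0 (-1)).
    by rewrite -(absvalX _ _ absP) sqrrN expr1n abs1 eqxx => /esym/eqP.
  by rewrite -detU absM det_perm (absvalX _ _ absP) absN1 expr1n mul1r.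
have Utr : is_trig_mx U^T by apply/is_trig_mxP => i j ij; rewrite mxE Uup.
have detUE : \det U = \prod_i U i i.
  by rewrite -det_tr det_trig //; apply: eq_bigr => i _; rewrite mxE.
have Uii i : U i i != 0.
  have : \det U != 0 by rewrite -detU mulf_neq0 // det_perm signr_eq0.
  by rewrite detUE => /prodf_neq0/(_ i); apply.
pose d : 'rV[F]_n.+1 := \row_i U i i.
(* Dividing each row of [U] by its diagonal entry leaves a unipotent matrix [1 + N]. *)
pose N := diag_mx (\row_i (U i i)^-1) *m U - 1.
have nN : N ^+ n.+1 = 0.
  apply: trmx_inj; rewrite trmx_expr trmx0; apply: strict_trig_nilpotent => i j.
  rewrite mxE /N mul_diag_mx !mxE leq_eqVlt => /orP[/eqP/val_inj->|ij].
    by rewrite eqxx mulVf ?subrr.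
  by rewrite (Uup j i) // mulr0 sub0r -val_eqE /= gtn_eqF // oppr0.
have -> : U = diag_mx d * (1 + N).
  rewrite /N addrC subrK -mulmxE; apply/matrixP=> i j.
  by rewrite !mul_diag_mx !mxE mulrA divff ?mul1r.
rewrite det_morphM (det_morph_unipotent nN) mulr1 -mulmxE det_mulmx.
by rewrite (det_unipotent nN) mulr1 -!(absvalX _ _ absP) det_morph_diag.
Qed.
End DetMorphism.

(** * Traces as coefficients of determinants *)

Definition det_pencil (F : fieldType) n (L : 'M[F]_n) : {poly F} :=
  \det (1%:M + 'X *: map_mx polyC L).

Lemma horner_det (F : fieldType) n (A : 'M[{poly F}]_n) x :
  (\det A).[x] = \det (map_mx (horner_eval x) A).
Proof. by rewrite det_map_mx. Qed.

Lemma horner_pencil_mx (F : fieldType) n (L : 'M[F]_n) x :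
  map_mx (horner_eval x) (1%:M + 'X *: map_mx polyC L) = 1%:M + x *: L.
Proof.
apply/matrixP=> i j; rewrite !mxE rmorphD rmorphM rmorph_nat /=.
by rewrite /horner_eval hornerX hornerC.
Qed.

Lemma det_pencilE (F : fieldType) n (L : 'M[F]_n) x :
  (det_pencil L).[x] = \det (1%:M + x *: L).
Proof. by rewrite horner_det horner_pencil_mx. Qed.

Lemma det_pencil0 (F : fieldType) n (L : 'M[F]_n) : (det_pencil L).[0] = 1.
Proof. by rewrite det_pencilE scale0r addr0 det1. Qed.

Section CharZero.
Variable F : fieldType.
Hypothesis char0 : forall k : nat, k.+1%:R != 0 :> F.

(* The pencil is the reversal of a characteristic polynomial. *)
Lemma det_pencil_coef1 n (L : 'M[F]_n.+1) : (det_pencil L)`_1 = \tr L.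
Proof.
pose c := char_poly (- L).
suff -> : det_pencil L = \poly_(i < n.+2) c`_(n.+1 - i).
  by rewrite coef_poly /= subn1 char_poly_trace // linearN opprK.
(* At a nonzero [x], [det(1 + xL)] equals [x^(n+1) c(1/x)]. *)
apply: (poly_eq_natr char0) => k; rewrite det_pencilE horner_poly.
move: (char0 k); set x := k.+1%:R => x0.
have -> : 1%:M + x *: L = x *: (x^-1%:M - - L).
  by rewrite opprK scalerDr scale_scalar_mx divff.
rewrite detZ.
have -> : \det (x^-1%:M - - L) = c.[x^-1].
  rewrite horner_det; congr (\det _); apply/matrixP=> i j.
  by rewrite !mxE rmorphB rmorphMn /= /horner_eval hornerX hornerC.
rewrite horner_coef size_char_poly mulr_sumr (reindex_inj rev_ord_inj) /=.
apply: eq_bigr => i _; rewrite subSS mulrCA; congr (_ * _).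
rewrite exprVn; apply: (canLR (mulfK _)); rewrite ?expf_neq0 //.
by rewrite -exprD subnKC // -ltnS.
Qed.

End CharZero.

Lemma coef1_exp (R : comNzRingType) (p : {poly R}) k :
  p.[0] = 1 -> (p ^+ k)`_1 = p`_1 *+ k.
Proof.
rewrite horner_coef0 => p0.
have pk0 j : (p ^+ j)`_0 = 1.
  elim: j => [|j IH]; first by rewrite expr0 coef1.
  by rewrite exprS coefM big_ord1 p0 IH mulr1.
elim: k => [|k IH]; first by rewrite expr0 coef1.
by rewrite exprS coefM big_ord_recl big_ord1 /= IH p0 pk0 mul1r mulr1 mulrSr.
Qed.

Lemma mxtrace_nondegenerate (R : comNzRingType) n (A : 'M[R]_n) :
  (forall B, \tr (A *m B) = 0) -> A = 0.
Proof.
move=> A0; apply/matrixP=> i j; rewrite mxE -[RHS](A0 (delta_mx j i)).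
rewrite /mxtrace (bigD1 i) //= big1 ?addr0 => [|k ki].
  rewrite mxE (bigD1 j) //= big1 ?addr0 => [|l lj].
    by rewrite mxE !eqxx mulr1.
  by rewrite mxE (negbTE lj) mulr0.
by rewrite mxE big1 // => l _; rewrite mxE (negbTE ki) andbF mulr0.
Qed.

Section TraceSeries.
Variables (F : fieldType) (n : nat) (M L : 'M[F]_n.+1).
Let AM : 'M[{poly F}]_n.+1 := 1%:M + 'X *: map_mx polyC (- M).
(** By Jacobi's formula, the coefficient of [t] in [det(1 - XM + tL)]. *)
Definition adj_trace : {poly F} := \tr (\adj AM *m map_mx polyC L).
(** The series of [tr((1 - XM)^-1 L)] cut after [X^2], as only squares are to be compared. *)
Definition power_traces : {poly F} := \poly_(k < 3) \tr (M ^+ k *m L).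

Lemma adj_traceE s :
  adj_trace.[s] = \tr (\adj (1%:M + s *: - M) *m L).
Proof.
rewrite -[LHS]/(horner_eval s adj_trace) -trace_map_mx map_mxM map_mx_adj.
rewrite horner_pencil_mx; congr (\tr (_ *m _)).
by apply/matrixP=> i j; rewrite !mxE /= /horner_eval hornerC.
Qed.

(* Truncation at order 3 of [adj(1 - XM) = det(1 - XM) * \sum_k (XM)^k]. *)
Lemma adj_trace_series : exists U : {poly F},
  adj_trace = det_pencil (- M) * power_traces + 'X^3 * U.
Proof.
pose MX : 'M[{poly F}]_n.+1 := map_mx polyC M.
exists (\tr (\adj AM * MX ^+ 3 * map_mx polyC L)).
have AME : AM = 1 - 'X *: MX by rewrite /AM map_mxN scalerN.
have geo : AM * \sum_(k < 3) ('X *: MX) ^+ k = 1 - 'X^3 *: MX ^+ 3.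
  by rewrite AME -[LHS]opprK -mulNr opprB -subrX1 opprB exprZn.
have ptE : power_traces = \tr ((\sum_(k < 3) ('X *: MX) ^+ k) * map_mx polyC L).
  rewrite mulr_suml linear_sum /= /power_traces poly_def; apply: eq_bigr => k _.
  rewrite exprZn -scalerAl linearZ /= -map_polyC_expr -mulmxE.
  by rewrite -map_mxM trace_map_mx mulrC mul_polyC.
have e : \det AM *: (\sum_(k < 3) ('X *: MX) ^+ k)
     = \adj AM - 'X^3 *: (\adj AM * MX ^+ 3).
  have -> X : \det AM *: X = \adj AM * AM * X.
    by rewrite -!mulmxE mul_adj_mx mul_scalar_mx.
  by rewrite -mulrA geo mulrBr mulr1 -scalerAr.
have eL : \adj AM * map_mx polyC L
    = \det AM *: ((\sum_(k < 3) ('X *: MX) ^+ k) * map_mx polyC L)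
      + 'X^3 *: (\adj AM * MX ^+ 3 * map_mx polyC L).
  by rewrite (scalerAl (\det AM)) e mulrBl -scalerAl subrK.
by rewrite /adj_trace mulmxE eL mxtraceD !mxtraceZ ptE.
Qed.
End TraceSeries.

(** Factor [P] out on the left, with its inverse written through the adjugate. *)
Lemma det_add_scale (F : fieldType) n (P L : 'M[F]_n.+1) t : \det P != 0 ->
  \det (P + t *: L)
  = \det P * (det_pencil ((\det P)^-1 *: (\adj P *m L))).[t].
Proof.
move=> P0; rewrite det_pencilE -det_mulmx mulmxDr mulmx1 -!scalemxAr mulmxA.
by rewrite mul_mx_adj mul_scalar_mx (scalerA _^-1) mulVf // scale1r.
Qed.

Section TraceComparison.
Variables (F : fieldType) (R : realDomainType) (abs : F -> R).
Hypothesis absP : absval abs.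
Let char0 := absval_char0 absP.
Let absM := absvalM absP.
Let abs_eq0 := absval_eq0 absP.
Variables (n m : nat).

(** After division by the values at [t = 0], both sides are absolute values of polynomials in [t]
    with constant term 1, so these polynomials coincide. Their linear coefficients are compared and
    the denominators cleared, which leaves an identity polynomial in the entries. *)
Lemma adj_trace_compare (P L : 'M[F]_n.+1) (Q K : 'M[F]_m.+1) :
  \det P != 0 -> \det Q != 0 ->
  (forall t, abs (\det (P + t *: L)) ^+ m.+1
           = abs (\det (Q + t *: K)) ^+ n.+1) ->
  (\tr (\adj P *m L) * \det Q) *+ m.+1 = (\tr (\adj Q *m K) * \det P) *+ n.+1.
Proof.
move=> P0 Q0 PQ.
set p := det_pencil ((\det P)^-1 *: (\adj P *m L)).
set q := det_pencil ((\det Q)^-1 *: (\adj Q *m K)).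
have pq : p ^+ m.+1 = q ^+ n.+1.
  apply: (absval_poly absP) => [||x];
    rewrite ?horner_exp ?det_pencil0 ?expr1n //.
  have := PQ 0; rewrite !scale0r !addr0 => PQ0.
  have := PQ x; rewrite !det_add_scale // !absM !exprMn PQ0 => /mulfI.
  by rewrite !(absvalX _ _ absP); apply; rewrite expf_neq0 // abs_eq0.
have := congr1 (fun r : {poly F} => r`_1) pq.
rewrite /p /q !coef1_exp ?det_pencil0 // !det_pencil_coef1 // !mxtraceZ.
move=> /(congr1 (fun x => x * \det P * \det Q)).
rewrite !mulrnAl; congr (_ *+ _ = _ *+ _).
  by rewrite [X in X * _ * _]mulrC divfK.
by rewrite mulrAC [X in X * _ * _]mulrC divfK.
Qed.

(** [adj_trace_compare] at [1 - sM] and [1 - sN] gives a polynomial identity in [s]; modulo [X^3]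
    the factor [DM * DN] cancels from it. *)
Lemma power_trace_compare (M L : 'M[F]_n.+1) (N K : 'M[F]_m.+1) :
  (forall s t, abs (\det (1%:M + s *: M + t *: L)) ^+ m.+1
             = abs (\det (1%:M + s *: N + t *: K)) ^+ n.+1) ->
  forall k, (k < 3)%N ->
    \tr (M ^+ k *m L) *+ m.+1 = \tr (N ^+ k *m K) *+ n.+1.
Proof.
move=> MN k k3.
pose DM := det_pencil (- M); pose DN := det_pencil (- N).
have DMN s : (DM.[s] == 0) = (DN.[s] == 0).
  have := MN (- s) 0; rewrite !scale0r !addr0 !scaleNr -!scalerN -!det_pencilE.
  move=> e; rewrite -[RHS]abs_eq0 -[LHS]abs_eq0.
  by rewrite -[LHS](expf_eq0 _ m.+1) e expf_eq0.
have TE : (adj_trace M L * DN) *+ m.+1 = (adj_trace N K * DM) *+ n.+1.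
  pose r := (adj_trace M L * DN) *+ m.+1 - (adj_trace N K * DM) *+ n.+1.
  (* The factor [DM] covers the points where [1 - sM] is singular and [adj_trace_compare] does not
     apply. *)
  suff /eqP : r * DM = 0.
    rewrite mulf_eq0 => /orP[|/eqP DM0]; first by rewrite subr_eq0 => /eqP.
    by have := det_pencil0 (- M); rewrite -/DM DM0 horner0 => /esym/eqP;
      rewrite oner_eq0.
  apply: (poly_eq0_natr char0) => j; move: j.+1%:R => s.
  rewrite hornerM; have [->|DMs] := eqVneq DM.[s] 0; first by rewrite mulr0.
  rewrite /r hornerD hornerN !hornerMn !hornerM !adj_traceE !det_pencilE.
  rewrite (@adj_trace_compare _ _ _ K) ?subrr ?mul0r // -?det_pencilE -?DMN //.
  by move=> t; rewrite !scalerN -!scaleNr.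
have [UM TM] := adj_trace_series M L; have [UN TN] := adj_trace_series N K.
pose g := power_traces M L *+ m.+1 - power_traces N K *+ n.+1.
suff g0 : g = 0.
  have := congr1 (fun r : {poly F} => r`_k) g0.
  rewrite coefB !coefMn !coef_poly k3 coef0 => /eqP.
  by rewrite subr_eq0 => /eqP.
have dvd : 'X^3 %| (DM * DN) * g.
  have -> : DM * DN * g
      = 'X^3 * ((UN * DM) *+ n.+1 - (UM * DN) *+ m.+1).
    rewrite /g mulrBr mulrBr !mulrnAr.
    have -> : DM * DN * power_traces M L = (adj_trace M L - 'X^3 * UM) * DN.
      by rewrite TM addrK mulrAC.
    have -> : DM * DN * power_traces N K = (adj_trace N K - 'X^3 * UN) * DM.
      by rewrite TN addrK [DM * DN]mulrC mulrAC.
    by rewrite !mulrBl !mulrnBl TE opprB addrC addrA subrK !mulrA.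
  by rewrite dvdp_mulr.
have cop : coprimep 'X^3 (DM * DN).
  rewrite coprimep_expl // coprimep_sym coprimepX /root hornerM !det_pencil0.
  by rewrite mulr1 oner_eq0.
(* [g] has degree at most 2, so it cannot be a nonzero multiple of ['X^3]. *)
apply/eqP/negPn/negP => g0; move: dvd.
rewrite Gauss_dvdpr // gtNdvdp // size_polyXn ltnS.
rewrite /g -!scaler_nat; apply: leq_trans (size_polyD _ _) _.
by rewrite geq_max size_polyN !(leq_trans (size_scale_leq _ _)) ?size_poly.
Qed.
End TraceComparison.

(** * Locally matrix algebras *)

Lemma linear_lrmorphism (F : fieldType) (A B : algType F)
    (f : {linear A -> B}) :
  f 1 = 1 -> {morph f : x y / x * y} ->
  exists g : {lrmorphism A -> B}, g =1 f.
Proof.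
move=> f1 fM.
pose g : {lrmorphism A -> B} := HB.pack (f : A -> B) f
  (GRing.isMonoidMorphism.Build A B f (conj f1 fM)).
by exists g.
Qed.

Lemma linear_comp_mull (F : fieldType) (A B : algType F)
    (f : {linear A -> B}) (x : B) :
  exists g : {linear A -> B}, g =1 (fun a => x * f a).
Proof. by exists (x \*o f). Qed.

Section LocallyMatrix.
Variables (F : fieldType) (A : algType F).

(** Once 1 lies in the image, [f 1], being the identity of the image, must be 1. *)
Lemma matrix_iso_lrmorphism n (f : {linear 'M[F]_n.+1 -> A}) (S : set A) :
  matrix_iso f S -> S 1 ->
  exists g : {lrmorphism 'M[F]_n.+1 -> A}, g =1 f /\ injective g.
Proof.
case=> fM [_ finj fsurj] S1.
have fMr : {morph f : x y / x * y} by move=> x y; rewrite -mulmxE fM.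
have f1 : f 1 = 1.
  have [M _ fM1] := fsurj _ S1.
  by rewrite -[LHS]mulr1 -fM1 -fMr mul1r.
have [g gf] := linear_lrmorphism f1 fMr.
by exists g; split=> // x y; rewrite !gf; apply: finj; rewrite inE.
Qed.

Lemma range_matrix_iso n (f : {lrmorphism 'M[F]_n.+1 -> A}) : injective f ->
  [/\ is_subalgebra (range f), range f 1 & matrix_iso f (range f)].
Proof.
move=> finj; split.
- split; first by exists 0; rewrite ?rmorph0.
  + by move=> _ _ [x _ <-] [y _ <-]; exists (x + y); rewrite ?rmorphD.
  + by move=> c _ [x _ <-]; exists (c *: x); rewrite ?linearZ.
  + by move=> _ _ [x _ <-] [y _ <-]; exists (x * y); rewrite ?rmorphM.
- by exists 1; rewrite ?rmorph1.
- split; first by move=> M N; rewrite mulmxE rmorphM.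
  split; first by move=> M _; exists M.
  + by move=> x y _ _; exact: finj.
  + by move=> _ [M _ <-]; exists M.
Qed.

Hypothesis hA : locally_matrix A.

Lemma local_model (s : seq A) :
  exists n (f : {lrmorphism 'M[F]_n.+1 -> A}),
    injective f /\ forall x, x \in s -> exists M, f M = x.
Proof.
(* Adding 1 to [s] makes the embedding unital. *)
have [S [_ sS] [n [n0 [f fS]]]] := hA (finite_seq (1 :: s)).
case: n n0 f fS => // n _ f fS.
have [g [gf ginj]] := matrix_iso_lrmorphism fS (sS 1 (mem_head _ _)).
exists n, g; split=> // x xs.
have /sS Sx : (x \in 1 :: s) by rewrite in_cons xs orbT.
have [_ [_ _ fsurj]] := fS; have [M _ fMx] := fsurj _ Sx.
by exists M; rewrite gf.
Qed.

Lemma algebra_char0_two_reg (char0 : forall k : nat, k.+1%:R != 0 :> F)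
  (x : A) : x + x = 0 -> x = 0.
Proof.
move/eqP; rewrite -mulr2n -scaler_nat scaler_eq0 => /orP[|/eqP //].
by rewrite (negbTE (char0 1)).
Qed.

(** In a matrix model, entry [(i, l)] of [M *m delta_mx j k *m N] is [M i j * N k l]. *)
Lemma locally_matrix_prime (x y : A) :
  (forall z, x * z * y = 0) -> x = 0 \/ y = 0.
Proof.
move=> xy; have [n [f [finj fs]]] := local_model [:: x; y].
have [M fM] : exists M, f M = x by apply: fs; rewrite !inE eqxx.
have [N fN] : exists N, f N = y by apply: fs; rewrite !inE eqxx orbT.
have [M0|[i [j Mij]]] : M = 0 \/ exists i j, M i j != 0.
  have [|M0] := pselect (exists i j, M i j != 0); first by right.
  left; apply/matrixP => i j; rewrite mxE; apply/eqP/negPn/negP => Mij.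
  by apply: M0; exists i, j.
  by left; rewrite -fM M0 rmorph0.
right; rewrite -fN; suff -> : N = 0 by rewrite rmorph0.
apply/matrixP => k l; rewrite mxE.
have : M *m delta_mx j k *m N = 0.
  by apply: finj; rewrite !mulmxE !rmorphM /= fM fN xy rmorph0.
move/(congr1 (fun X : 'M[F]_n.+1 => X i l)); rewrite mxE (bigD1 k) //= big1.
  rewrite !mxE (bigD1 j) //= big1 ?addr0 => [|r rj].
    by rewrite mxE !eqxx mulr1 => /eqP; rewrite mulf_eq0 (negbTE Mij) => /eqP.
  by rewrite mxE (negbTE rj) mulr0.
move=> r rk; rewrite mxE big1 ?mul0r // => r' _.
by rewrite mxE (negbTE rk) andbF mulr0.
Qed.

(** By linearity the image of [u] contains that of [f], and [h] is [f] followed by the inverse of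
    [u]. *)
Lemma lrmorphism_factor n m (f : {lrmorphism 'M[F]_n.+1 -> A})
    (u : {lrmorphism 'M[F]_m.+1 -> A}) : injective f -> injective u ->
  (forall i j, exists M, u M = f (delta_mx i j)) ->
  exists h : {lrmorphism 'M[F]_n.+1 -> 'M[F]_m.+1},
    injective h /\ forall M, u (h M) = f M.
Proof.
move=> finj uinj fu.
have /choice[h uh] : forall M, exists N, u N = f M.
  move=> M; rewrite [M]matrix_sum_delta linear_sum.
  have /choice[N uN] i : exists N, u N = f (\sum_j M i j *: delta_mx i j).
    have /choice[N uN] j : exists N, u N = f (M i j *: delta_mx i j).
      by have [N uN] := fu i j; exists (M i j *: N); rewrite !linearZ /= uN.
    exists (\sum_j N j); rewrite !linear_sum.
    by apply: eq_bigr => j _; exact: uN.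
  by exists (\sum_i N i); rewrite linear_sum; apply: eq_bigr => i _; exact: uN.
have hlin : linear h.
  by move=> a x y; apply: uinj; rewrite uh !linearP /= !uh.
pose hl : {linear 'M[F]_n.+1 -> 'M[F]_m.+1} :=
  HB.pack h (GRing.isLinear.Build F _ _ _ h hlin).
have h1 : hl 1 = 1 by apply: uinj; rewrite uh !rmorph1.
have hM : {morph hl : x y / x * y}.
  by move=> x y; apply: uinj; rewrite uh !rmorphM /= !uh.
have [g gh] := linear_lrmorphism h1 hM.
exists g; split=> [x y|M]; last by rewrite gh uh.
by rewrite !gh => /(congr1 u); rewrite !uh => /finj.
Qed.

End LocallyMatrix.

(** * The normalized determinant *)

Section NormDet.
Variables (R : realType) (F : fieldType) (abs : F -> R).
Hypothesis absP : absval abs.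

Lemma powR_inv_natK (x : R) n : 0 <= x -> (x `^ n.+1%:R^-1) ^+ n.+1 = x.
Proof.
by move=> x0; rewrite -powR_mulrn ?powR_ge0 // -powRrM mulVf ?powRr1.
Qed.

Lemma powR_inv_nat_eq (x y : R) n m : 0 <= x -> 0 <= y ->
  x `^ n.+1%:R^-1 = y `^ m.+1%:R^-1 <-> x ^+ m.+1 = y ^+ n.+1.
Proof.
move=> x0 y0; split=> [xy|xy].
  rewrite -{1}(powR_inv_natK n x0) -{1}(powR_inv_natK m y0) xy.
  by rewrite -!exprM mulnC.
apply/eqP; rewrite -(@eqrXn2 _ (n.+1 * m.+1)) ?powR_ge0 //.
by rewrite exprM [X in _ == _ ^+ X]mulnC exprM !powR_inv_natK // xy.
Qed.

Variable A : algType F.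
Hypothesis hA : locally_matrix A.

(** Independence of the model: both models embed in a third one containing their matrix units, where
    [abs_det_morph] compares the determinants. *)
Lemma abs_det_compare n m (f : {lrmorphism 'M[F]_n.+1 -> A})
    (g : {lrmorphism 'M[F]_m.+1 -> A}) M N : injective f -> injective g ->
  f M = g N -> abs (\det M) ^+ m.+1 = abs (\det N) ^+ n.+1.
Proof.
move=> finj ginj fMgN.
pose s := [seq f (delta_mx p.1 p.2) | p : 'I_n.+1 * 'I_n.+1]
       ++ [seq g (delta_mx p.1 p.2) | p : 'I_m.+1 * 'I_m.+1].
have [k [u [uinj us]]] := local_model hA s.
have [i j|h [hinj uh]] := lrmorphism_factor finj uinj.
  by apply: us; rewrite mem_cat; apply/orP; left; apply/mapP;
  exists (i, j); rewrite ?mem_enum.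
have [i j|h' [h'inj uh']] := lrmorphism_factor ginj uinj.
  by apply: us; rewrite mem_cat; apply/orP; right; apply/mapP;
  exists (i, j); rewrite ?mem_enum.
have hh' : h M = h' N by apply: uinj; rewrite uh uh'.
have := abs_det_morph absP hinj M; have := abs_det_morph absP h'inj N.
rewrite hh' => eN eM.
have a0 := absval_ge0 absP.
apply/eqP; rewrite -(@eqrXn2 _ k.+1) ?exprn_ge0 //.
by rewrite -!exprM ![(_ * k.+1)%N]mulnC !exprM -eM -eN -!exprM mulnC.
Qed.

(** By [abs_det_compare] the set given to [xget] is a singleton. *)
Lemma norm_detE n (f : {lrmorphism 'M[F]_n.+1 -> A}) M : injective f ->
  norm_det abs (f M) = abs (\det M) `^ n.+1%:R^-1.
Proof.
move=> finj; apply: xget_unique.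
  have [Ssub S1 iso] := range_matrix_iso finj.
  exists (range f); first by split=> //; exists M.
  by exists n.+1; split=> //; exists f; split=> //; exists M.
move=> d [S [_ S1 _] [m [m0 [g [giso [N gN ->]]]]]].
case: m m0 g giso N gN => // m _ g giso N gN.
have [g' [g'g g'inj]] := matrix_iso_lrmorphism giso S1.
apply/powR_inv_nat_eq; rewrite ?(absval_ge0 absP) //.
by apply: (abs_det_compare g'inj finj); rewrite g'g.
Qed.

Lemma norm_det1 : norm_det abs (1 : A) = 1.
Proof.
have [n [f [finj _]]] := local_model hA [::].
by rewrite -(rmorph1 f) norm_detE // det1 (absval1 absP) powR1.
Qed.

Lemma norm_detM (x y : A) :
  norm_det abs (x * y) = norm_det abs x * norm_det abs y.
Proof.
have [n [f [finj fs]]] := local_model hA [:: x; y].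
have [M <-] : exists M, f M = x by apply: fs; rewrite !inE eqxx.
have [N <-] : exists N, f N = y by apply: fs; rewrite !inE eqxx orbT.
rewrite -rmorphM !norm_detE // -mulmxE det_mulmx (absvalM absP).
by rewrite powRM ?(absval_ge0 absP).
Qed.

Lemma norm_det_invertible (x : A) : norm_det abs x != 0 -> invertible x.
Proof.
have [n [f [finj fs]]] := local_model hA [:: x].
have [M <-] : exists M, f M = x by apply: fs; rewrite !inE eqxx.
rewrite norm_detE // => d0; have Mu : M \in unitmx.
  rewrite unitmxE unitfE -(absval_eq0 absP); apply: contraNneq d0 => ->.
  by rewrite powR0 // invr_eq0 pnatr_eq0.
exists (f (invmx M)).
by rewrite -!rmorphM -mulmxE mulVmx // mulmxV // rmorph1.
Qed.

End NormDet.

(** * Unital preservers of the normalized determinant *)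

Section UnitalPreserver.
Variables (R : realType) (F : fieldType) (abs : F -> R).
Hypothesis absP : absval abs.
Variables (A B : algType F).
Hypotheses (hA : locally_matrix A) (hB : locally_matrix B).
Variable psi : {linear A -> B}.
Hypothesis psi1 : psi 1 = 1.
Hypothesis psi_det : preserves_norm_det abs psi.
Hypothesis psi_surj : forall b, exists a, psi a = b.

(** As [psi] is linear and unital, it carries the whole pencil [1 + sM + tL] to [1 + sN + tK]. *)
Lemma preserver_power_trace n m (f : {lrmorphism 'M[F]_n.+1 -> A})
    (g : {lrmorphism 'M[F]_m.+1 -> B}) M L N K : injective f -> injective g ->
  psi (f M) = g N -> psi (f L) = g K -> forall k, (k < 3)%N ->
  \tr (M ^+ k *m L) *+ m.+1 = \tr (N ^+ k *m K) *+ n.+1.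
Proof.
move=> finj ginj MN LK.
apply: (power_trace_compare absP) => s t.
apply/(powR_inv_nat_eq n m); rewrite ?(absval_ge0 absP) //.
rewrite -(norm_detE absP hA _ finj) -(norm_detE absP hB _ ginj) -psi_det.
congr norm_det; rewrite !linearD !linearZ /=.
rewrite -[1%:M]/(1 : 'M[F]_n.+1) rmorph1 psi1.
by rewrite -[1%:M]/(1 : 'M[F]_m.+1) rmorph1 MN LK.
Qed.

(** If [psi a = 0], the case [k = 1] with [N = 0] says that the matrix of [a] is trace orthogonal to
    every [L]. *)
Lemma preserver_inj : injective psi.
Proof.
suff psi0 a : psi a = 0 -> a = 0.
  by move=> x y xy; apply/subr0_eq/psi0; rewrite linearB /= xy subrr.
move=> psia; have [n [f [finj fs]]] := local_model hA [:: a].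
have [M fM] : exists M, f M = a by apply: fs; rewrite !inE eqxx.
rewrite -fM; suff -> : M = 0 by rewrite rmorph0.
apply: mxtrace_nondegenerate => L.
have [m [g [ginj gs]]] := local_model hB [:: psi (f L)].
have [K gK] : exists K, g K = psi (f L) by apply: gs; rewrite !inE eqxx.
have MN : psi (f M) = g 0 by rewrite fM psia rmorph0.
have := preserver_power_trace finj ginj MN (esym gK) (isT : 1 < 3)%N.
rewrite !expr1 mul0mx mxtrace0 mul0rn -[X in _ = X -> _](mul0rn _ m.+1).
by move/(mulrSn_inj (absval_char0 absP)).
Qed.

(* Both [psi c ^ 2] and [psi (c ^ 2)] have the same trace pairing with every
   [psi b], namely that of [c ^ 2] with [b]. *)
Lemma preserver_sqr c : psi (c * c) = psi c * psi c.
Proof.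
have [m [g [ginj gs]]] := local_model hB [:: psi c; psi (c * c)].
have [N gN] : exists N, g N = psi c by apply: gs; rewrite !inE eqxx.
have [N2 gN2] : exists N, g N = psi (c * c).
  by apply: gs; rewrite !inE eqxx orbT.
rewrite -gN2 -gN -rmorphM; congr (g _); apply: subr0_eq.
apply: mxtrace_nondegenerate => K.
have [b psib] := psi_surj (g K).
have [n [f [finj fs]]] := local_model hA [:: c; b].
have [M fM] : exists M, f M = c by apply: fs; rewrite !inE eqxx.
have [L fL] : exists L, f L = b by apply: fs; rewrite !inE eqxx orbT.
have LK : psi (f L) = g K by rewrite fL.
have MN : psi (f M) = g N by rewrite fM gN.
have MN2 : psi (f (M * M)) = g N2 by rewrite rmorphM /= fM gN2.
(* The case [k = 2] for [c] and the case [k = 1] for [c * c] have the same left-hand side. *)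
have := preserver_power_trace finj ginj MN LK (isT : 2 < 3)%N.
have := preserver_power_trace finj ginj MN2 LK (isT : 1 < 3)%N.
rewrite !expr1 !expr2 => -> /(mulrSn_inj (absval_char0 absP)) N2N.
by rewrite mulmxBl raddfB /= N2N subrr.
Qed.

Lemma unital_preserver :
  (exists phi1 : {lrmorphism A -> B}, bijective phi1 /\ phi1 =1 psi) \/
  (antihomomorphism psi /\ bijective psi).
Proof.
have psi_bij : bijective psi.
  have /choice[g gK] := psi_surj; exists g => // a.
  by apply: preserver_inj; rewrite gK.
have [psiM|psiM] := jordan_hom_or_antihom
  (algebra_char0_two_reg (A := B) (absval_char0 absP))
  (locally_matrix_prime hB) preserver_sqr psi_surj; last by right.
have [g gpsi] := linear_lrmorphism psi1 psiM.
by left; exists g; split=> //; apply: eq_bij psi_bij _ _ => x.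
Qed.

End UnitalPreserver.

Theorem theorem2 (R : realType) (F : fieldType) (abs : F -> R)
    (hF : real_or_complex abs)
    (A B : algType F)
    (hA : locally_matrix A) (hB : locally_matrix B)
    (phi : {linear A -> B})
    (phi_surj : forall b : B, exists a : A, phi a = b)
    (phi_det : preserves_norm_det abs phi) :
  exists X Y : B,
    [/\ invertible X, invertible Y, norm_det abs (X * Y) = 1 &
      (exists phi1 : {lrmorphism A -> B},
         bijective phi1 /\ forall a : A, phi a = X * phi1 a * Y)
      \/
      (exists phi2 : {linear A -> B},
         [/\ antihomomorphism phi2, bijective phi2 &
             forall a : A, phi a = X * phi2 a * Y])].
Proof.
have absP := real_or_complex_absval hF.
have X1 : norm_det abs (phi 1) = 1 by rewrite phi_det norm_det1.
have [Z [ZX XZ]] : invertible (phi 1).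
  by apply: (norm_det_invertible absP hB); rewrite X1 oner_eq0.
have Z1 : norm_det abs Z = 1.
  by rewrite -[LHS]mulr1 -X1 -norm_detM // ZX norm_det1.
have [psi psiE] := linear_comp_mull phi Z.
have phiE a : phi a = phi 1 * psi a by rewrite psiE mulrA XZ mul1r.
(* The whole correction is placed on the left, so [Y = 1]. *)
exists (phi 1), 1; split; first by exists Z.
- by exists 1; rewrite mulr1.
- by rewrite mulr1.
have psi_det : preserves_norm_det abs psi.
  by move=> a; rewrite psiE norm_detM // Z1 mul1r phi_det.
have psi_surj b : exists a, psi a = b.
  have [a phia] := phi_surj (phi 1 * b).
  by exists a; rewrite psiE phia mulrA ZX mul1r.
have psi1 : psi 1 = 1 by rewrite psiE.
have [[phi1 [bij phi1E]]|[anti bij]] :=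
  unital_preserver absP hA hB psi1 psi_det psi_surj; [left | right].
  by exists phi1; split=> // a; rewrite mulr1 phi1E.
by exists psi; split=> // a; rewrite mulr1.
Qed.
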